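(* Let $E$ and $Z$ be real Hausdorff topological vector spaces, let $X\subset E$ be a convex set, let $Y\subset Z$ be compact, and let $S$ be a pointed closed convex cone in $Z$ with $\operatorname{int}S\neq\emptyset$. Let $F:X\times X\rightrightarrows Y$ be a set-valued map with non-empty values. (i) Suppose that $\bigcup_{y\in X}F(x,y)$ is compact for each $x\in X$. If $F$ is $S$-transfer weakly type-(v) $\mu$-convex in the first argument on $X\times X$, transfer type-(iii) properly $S$-quasi-concave in the first argument on $X\times X$, and satisfies condition $(\gamma)$, then there exist $z_1\in \operatorname{Max}\overline{\bigcup_{x\in X}F(x,x)}$ and $z_2\in\operatorname{Min}\overline{\bigcup_{x\in X}\operatorname{Max}_w F(x,X)}$ such that $z_1\in z_2+S$. (ii) Suppose that $\bigcup_{x\in X}F(x,y)$ is compact for each $y\in X$. If $F$ is $S$-transfer weakly type-(v) $\mu$-concave in the second argument on $X\times X$, transfer type-(iii) properly $S$-quasi-convex in the second argument on $X\times X$, and satisfies condition $(\gamma')$, then there exist $z_1\in \operatorname{Min}\overline{\bigcup_{x\in X}F(x,x)}$ and $z_2\in\operatorname{Max}\overline{\bigcup_{y\in X}\operatorname{Min}_w F(X,y)}$ such that $z_1\in z_2-S$.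
   Context: Notation: $\overline{A}$ is the closure and $\operatorname{co}A$ the convex hull of $A$. $F(x,X)=\bigcup_{y\in X}F(x,y)$, $F(X,y)=\bigcup_{x\in X}F(x,y)$. $-F$ is the map $(x,y)\mapsto -F(x,y)$. $\Delta_{m-1}=\{\lambda\in\mathbb{R}^m:\lambda_i\ge 0,\ \sum_i\lambda_i=1\}$. For non-empty $A\subset Z$: $z\in A$ belongs to $\operatorname{Min}A$ iff $A\cap(z-S)=\{z\}$; to $\operatorname{Max}A$ iff $A\cap(z+S)=\{z\}$; to $\operatorname{Min}_wA$ iff $A\cap(z-\operatorname{int}S)=\emptyset$; to $\operatorname{Max}_wA$ iff $A\cap(z+\operatorname{int}S)=\emptyset$. $F$ is $S$-transfer weakly type-(v) $\mu$-convex in the first argument on $X\times X$ iff for each $m\ge1$, $x_1,\dots,x_m\in X$ and $z\in X$ there exist $i_0\in\{1,\dots,m\}$ and $z_{i_0}\in X$ (depending on $x_1,\dots,x_m,z$) such that, for every $\lambda\in\Delta_{m-1}$, writing $x_\lambda=\sum_j\lambda_jx_j$: - if $F(x_\lambda,z)\cap \operatorname{Max}_w\bigcup_{y\in X}F(x_\lambda,y)\neq\emptyset$, then $F(x_\lambda,z)\cap\bigcup_{y\in X}F(x_{i_0},y)\subset F(x_{i_0},z_{i_0})-S$; - if $F(x_\lambda,z)\cap \operatorname{Max}_w\bigcup_{y\in X}F(x_\lambda,y)=\emptyset$, then $F(x_\lambda,z)\cap\bigcup_{y\in X}F(x_{i_0},y)\subset F(x_{i_0},z_{i_0})-\operatorname{int}S$.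 $F$ is transfer type-(iii) properly $S$-quasi-convex in the first argument on $X\times X$ iff for all $x_1,x_2,z\in X$, $\lambda\in(0,1)$ and $i\in\{1,2\}$: $F(\lambda x_1+(1-\lambda)x_2,z)\cap\operatorname{Min}_w\bigcup_{y\in X}F(x_i,y)=\emptyset$ implies $F(x_i,z)\subset F(\lambda x_1+(1-\lambda)x_2,z)+S$. For each of these two properties: $F$ has the ''concave'' version iff $-F$ has the ''convex'' version; and $F$ has the property in the second argument iff the map $(x,y)\mapsto F(y,x)$ has it in the first argument. Condition $(\gamma)$: there exist $m\ge1$, $(x_1,y_1),\dots,(x_m,y_m)\in X\times X$ and $y^*\in\operatorname{co}\{x_1,\dots,x_m\}$ such that for each $i$: $F(x_i,y_i)\subset F(x_i,y^* )-S$ and $F(x_i,y_i)\cap\operatorname{Max}_w\bigcup_{z\in X}F(x_i,z)\neq\emptyset$. Condition $(\gamma')$: there exist $m\ge1$, $(x_1,y_1),\dots,(x_m,y_m)\in X\times X$ and $x^*\in\operatorname{co}\{y_1,\dots,y_m\}$ such that for each $i$: $F(x_i,y_i)\subset F(x^*,y_i)+S$ and $F(x_i,y_i)\cap\operatorname{Min}_w\bigcup_{x\in X}F(x,y_i)\neq\emptyset$. *)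

(* Defs.v *)
From HB Require Import structures.
From mathcomp Require Import all_boot all_order all_algebra.
From mathcomp Require Import all_classical all_reals all_analysis.

Set Implicit Arguments.
Unset Strict Implicit.
Unset Printing Implicit Defensive.

Import Order.TTheory GRing.Theory Num.Theory.
Import numFieldNormedType.Exports.

Local Open Scope classical_set_scope.
Local Open Scope ring_scope.

(* [topologicalLmodType R] is used for topological vector spaces because
   [tvsType R] also requires local convexity. *)

Section Cones.
Context {R : realType} {Z : topologicalLmodType R}.
Implicit Types (S A : set Z) (z : Z).

Definition cone S : Prop :=
  forall (t : R) z, 0 <= t -> S z -> S (t *: z).

Definition pointed_closed_convex_cone S : Prop :=
  [/\ closed S, convex_set S, cone S & S `&` [set - s | s in S] = [set 0]].

Definition addS A S : set Z := [set a + s | a in A & s in S].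
Definition subS A S : set Z := [set a - s | a in A & s in S].

Definition Min S A : set Z := [set z | A z /\ A `&` subS [set z] S = [set z]].
Definition Max S A : set Z := [set z | A z /\ A `&` addS [set z] S = [set z]].
Definition Minw S A : set Z :=
  [set z | A z /\ A `&` subS [set z] (interior S) = set0].
Definition Maxw S A : set Z :=
  [set z | A z /\ A `&` addS [set z] (interior S) = set0].

End Cones.

Definition convex_hull {R : realType} {E : lmodType R} (A : set E) : set E :=
  smallest (@convex_set R E) A.

Definition simplex {R : realType} (m : nat) : set ('I_m -> R) :=
  [set l | (forall i, 0 <= l i) /\ \sum_(i < m) l i = 1].

(* Set-valued maps X x X => Z are total functions E -> E -> set Z; only their
   values on X x X are used. *)
Section SetValuedMaps.
Context {R : realType} {E Z : topologicalLmodType R}.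
Implicit Types (X : set E) (S : set Z) (F : E -> E -> set Z).

Definition oppF F : E -> E -> set Z := fun x y => [set - z | z in F x y].

Definition swapF F : E -> E -> set Z := fun x y => F y x.

Definition weakly_type_v_mu_convex1 S X F : Prop :=
  forall (m : nat) (x : 'I_m -> E) (z : E),
    (1 <= m)%N -> (forall i, X (x i)) -> X z ->
    exists (i0 : 'I_m) (z0 : E), X z0 /\
      forall l : 'I_m -> R, simplex l ->
        let xl := \sum_(j < m) l j *: x j in
        let hit := F xl z `&` Maxw S (\bigcup_(y in X) F xl y) in
        (hit !=set0 ->
          F xl z `&` \bigcup_(y in X) F (x i0) y `<=` subS (F (x i0) z0) S) /\
        (hit = set0 ->
          F xl z `&` \bigcup_(y in X) F (x i0) y
            `<=` subS (F (x i0) z0) (interior S)).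

Definition weakly_type_v_mu_concave1 S X F : Prop :=
  weakly_type_v_mu_convex1 S X (oppF F).

Definition weakly_type_v_mu_concave2 S X F : Prop :=
  weakly_type_v_mu_concave1 S X (swapF F).

Definition type_iii_properly_quasiconvex1 S X F : Prop :=
  forall (x1 x2 z : E) (l : R),
    X x1 -> X x2 -> X z -> 0 < l < 1 ->
    let xl := l *: x1 + (1 - l) *: x2 in
    forall xi : E, xi = x1 \/ xi = x2 ->
      F xl z `&` Minw S (\bigcup_(y in X) F xi y) = set0 ->
      F xi z `<=` addS (F xl z) S.

Definition type_iii_properly_quasiconcave1 S X F : Prop :=
  type_iii_properly_quasiconvex1 S X (oppF F).

Definition type_iii_properly_quasiconvex2 S X F : Prop :=
  type_iii_properly_quasiconvex1 S X (swapF F).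

Definition condition_gamma S X F : Prop :=
  exists (m : nat) (x y : 'I_m -> E) (ystar : E),
    [/\ (1 <= m)%N, forall i, X (x i) /\ X (y i),
        convex_hull (range x) ystar
      & forall i, F (x i) (y i) `<=` subS (F (x i) ystar) S /\
          F (x i) (y i) `&` Maxw S (\bigcup_(z in X) F (x i) z) !=set0].

Definition condition_gamma' S X F : Prop :=
  exists (m : nat) (x y : 'I_m -> E) (xstar : E),
    [/\ (1 <= m)%N, forall i, X (x i) /\ X (y i),
        convex_hull (range y) xstar
      & forall i, F (x i) (y i) `<=` addS (F xstar (y i)) S /\
          F (x i) (y i) `&` Minw S (\bigcup_(z in X) F z (y i)) !=set0].

End SetValuedMaps.

(* Main.v *)
Require Import Defs.
From HB Require Import structures.
From mathcomp Require Import all_boot all_order all_algebra.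
From mathcomp Require Import all_classical all_reals all_analysis.

(** Let G be -F in part (i) and (x, y) |-> F y x in part (ii), so that both parts
concern a properly quasi-convex G whose values G(x_i, y) meet Min_w G(x_i, X)
at a point y of co{x_i}. Write y = t x_i + (1 - t) x' with t > 0. If G(y, y)
meets Min_w G(x_i, X), a common point is both a diagonal value and a weakly
minimal one; otherwise quasi-convexity gives G(x_i, y) <= G(y, y) + S. In both
cases some diagonal value lies below some weakly minimal value. Every point of
a compact set being dominated by a maximal (minimal) one, passing to the
compact closures yields the claim. *)

Set Implicit Arguments.
Unset Strict Implicit.
Unset Printing Implicit Defensive.

Import Order.TTheory GRing.Theory Num.Theory.
Import numFieldNormedType.Exports.
Local Open Scope classical_set_scope.
Local Open Scope ring_scope.

Lemma convex_setP {R : realType} {E : lmodType R} (A : set E) :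
  @convex_set R E A <->
  forall x y t, 0 <= t -> t <= 1 -> A x -> A y -> A (t *: x + (1 - t) *: y).
Proof.
split=> [cA x y t t0 t1 Ax Ay|cA x y l]; last first.
  by rewrite !inE; apply: cA.
by have := cA x y (Itv01 t0 t1) (mem_set Ax) (mem_set Ay); rewrite inE.
Qed.

(** * The order induced by a pointed closed convex cone *)

Section ConeOrder.
Context {R : realType} {Z : topologicalLmodType R}.
Implicit Types (S A Y : set Z).

Lemma pccc0 S : pointed_closed_convex_cone S -> S 0.
Proof. by case=> _ _ _ h; have [] : (S `&` [set - s | s in S]) 0 by rewrite h. Qed.

Lemma pccc_antisym S z :
  pointed_closed_convex_cone S -> S z -> S (- z) -> z = 0.
Proof.
case=> _ _ _ h Sz SNz.
have : (S `&` [set - s | s in S]) z.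
  by split=> //; exists (- z) => //; rewrite opprK.
by rewrite h.
Qed.

(** The sum is twice a midpoint, so convexity and stability under scaling suffice. *)
Lemma pcccD S u v :
  pointed_closed_convex_cone S -> S u -> S v -> S (u + v).
Proof.
case=> _ cS kS _ Su Sv.
have h : S (2^-1 *: u + (1 - 2^-1) *: v).
  by move/convex_setP: cS; apply => //; rewrite ?invr_ge0// invf_le1// ler1n.
have -> : u + v = 2 *: (2^-1 *: u + (1 - 2^-1) *: v).
  rewrite scalerDr !scalerA mulrBr mulfV// mulr1.
  by rewrite (mulr2n 1) addrK !scale1r.
by apply: kS.
Qed.

Lemma pccc_trans S u v w : pointed_closed_convex_cone S ->
  S (v - u) -> S (w - v) -> S (w - u).
Proof.
by move=> hS Suv Svw; rewrite -(subrK v w) -addrA; exact: pcccD.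
Qed.

(** Reversing the cone exchanges maximal and minimal points; the existence of minimal points is
    deduced in this way from [exists_Max_closure]. *)
Lemma pcccN S :
  pointed_closed_convex_cone S -> pointed_closed_convex_cone (-%R @^-1` S).
Proof.
case=> clS cS kS pS; split.
- by apply: preimage_closed => // z _; exact: opp_continuous.
- apply/convex_setP => u v t t0 t1 Su Sv.
  by rewrite /= opprD -!scalerN; move/convex_setP: cS; exact.
- by move=> t z t0 /= Sz; rewrite -scalerN; exact: kS.
- have hS : pointed_closed_convex_cone S by [].
  apply/seteqP; split=> [z [/= SNz [s SNs sz]]|z ->] /=.
    have Sz : S z by rewrite -sz.
    exact: pccc_antisym hS Sz SNz.
  split; first by rewrite /= oppr0; exact: pccc0.
  by exists 0; rewrite /= ?oppr0 //; exact: pccc0.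
Qed.

(** Translation by [s] turns the neighbourhood [S] of [u] into a neighbourhood of [s + u], which
    stays in [S] by additivity. *)
Lemma interior_pcccD S s u : pointed_closed_convex_cone S ->
  S s -> interior S u -> interior S (s + u).
Proof.
move=> hS Ss Su; rewrite /interior /=.
apply: filterS (nbhsB_subproof (@add_continuous Z) s Su) => _ [v Sv <-].
exact: pcccD.
Qed.

Lemma addS1P S z w : addS [set z] S w <-> S (w - z).
Proof.
split=> [[_ -> [s Ss <-]]|Sz]; first by rewrite addrC addKr.
by exists z => //; exists (w - z) => //; rewrite addrC subrK.
Qed.

Lemma subS1P S z w : subS [set z] S w <-> S (z - w).
Proof.
split=> [[_ -> [s Ss <-]]|Sz]; first by rewrite opprB addrC subrK.
by exists z => //; exists (z - w) => //; rewrite opprB addrC subrK.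
Qed.

Lemma Max_Min S A : Max (-%R @^-1` S) A = Min S A.
Proof.
rewrite /Max /Min; congr mkset; apply/funext=> z; congr (_ /\ (_ `&` _ = _)).
by apply/seteqP; split=> w; rewrite addS1P subS1P /= opprB.
Qed.

Lemma Maxw_oppE S A : [set - z | z in Maxw S A] = Minw S [set - z | z in A].
Proof.
apply/seteqP; split=> [_ [z [Az z0] <-]|_ [[z Az <-] z0]].
  split; first by exists z.
  rewrite -subset0 => _ [[w Aw <-] /subS1P iw].
  suff : (A `&` addS [set z] (interior S)) w by rewrite z0.
  by split=> //; apply/addS1P; rewrite addrC -(opprK w).
exists z => //; split=> //; rewrite -subset0 => w [Aw /addS1P iw].
suff : ([set - z | z in A] `&` subS [set - z] (interior S)) (- w).
  by rewrite z0.
by split; [exists w|apply/subS1P; rewrite opprK addrC].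
Qed.

(* In a compact set, a chain c has an upper bound: a cluster point of the filter
   generated by the closed sections A `&` (c + S). *)
Lemma exists_Max S A a : pointed_closed_convex_cone S -> compact A -> A a ->
  exists2 z, Max S A z & S (z - a).
Proof.
move=> hS cA Aa.
(* Zorn's lemma is applied only to the points of [A] above [a], so that the maximal point found
   dominates [a]. *)
pose T := {z : Z | A z /\ S (z - a)}.
have Saa : S (a - a) by rewrite subrr; exact: pccc0.
pose r := [rel u v : T | `[< S (sval v - sval u) >]].
have rr (t : T) : r t t by apply/asboolP; rewrite subrr; exact: pccc0.
have rt (u v w : T) : r u v -> r v w -> r u w.
  move=> /asboolP uv /asboolP vw; apply/asboolP.
  exact: pccc_trans hS uv vw.
have [] := ZL_preorder (exist _ a (conj Aa Saa) : T) rr rt.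
  move=> C totC.
  have [[c0 Cc0]|C0] := pselect (C !=set0); last first.
    by exists (exist _ a (conj Aa Saa)) => s Cs; case: C0; exists s.
  pose B (c : T) := [set z | A z /\ S (z - sval c)].
  pose G := filter_from C B.
  have GF : ProperFilter G.
    apply: filter_from_proper => [|c _]; last first.
      by exists (sval c); rewrite /B/= subrr; split; [case: (svalP c)|exact: pccc0].
    apply: filter_from_filter; first by exists c0.
    (* The sections of two comparable points are nested, so the smaller one lies in their
       intersection. *)
    move=> c d Cc Cd.
    have [/asboolP cd|/asboolP dc] := totC c d Cc Cd.
      exists d => // z [Az Sz].
      by split; split=> //; exact: pccc_trans hS cd Sz.
    exists c => // z [Az Sz].
    by split; split=> //; exact: pccc_trans hS dc Sz.
  have GA : G A by exists c0 => // z [].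
  have [p [Ap]] := cA G GF GA; rewrite clusterE => clp.
  have Sp c : C c -> S (p - sval c).
    move=> Cc.
    have : closure (B c) p by apply: clp; exists c.
    have clc : closed [set z | S (z - sval c)].
      apply: (@preimage_closed _ _ (fun z : Z => z - sval c)); last by case: hS.
      move=> z _.
      apply: (@continuous_comp _ _ _ (fun z : Z => (z, - sval c))
        (fun z : Z * Z => z.1 + z.2)); last exact: add_continuous.
      by apply: cvg_pair; [exact: cvg_id|exact: cvg_cst].
    by move=> /(closureS (_ : B c `<=` [set z | S (z - sval c)])) /clc; apply => z [].
  have Spa : S (p - a).
    by apply: (pccc_trans hS _ (Sp _ Cc0)); case: (svalP c0).
  by exists (exist _ p (conj Ap Spa)) => c Cc; apply/asboolP; exact: Sp.
move=> [z [Az Sza]] zmax; exists z => //; split=> //.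
apply/seteqP; split=> [w [Aw /addS1P Swz]|w ->]; last first.
  by split=> //; apply/addS1P; rewrite subrr; exact: pccc0.
(* A point [w] above [z] is still above [a], so maximality gives [w] below [z]; pointedness of the
   cone then forces equality. *)
have Swa : S (w - a) := pccc_trans hS Sza Swz.
have /asboolP /= Szw := zmax (exist _ w (conj Aw Swa)) (asboolT Swz).
by apply/subr0_eq/(pccc_antisym hS) => //; rewrite opprB.
Qed.

(** In a Hausdorff space the compact set [Y] is closed, so the closure of [A] stays in [Y] and is
    itself compact. *)
Lemma exists_Max_closure S Y A a : hausdorff_space Z -> compact Y ->
  pointed_closed_convex_cone S -> A `<=` Y -> A a ->
  exists2 z, Max S (closure A) z & S (z - a).
Proof.
move=> hZ cY hS AY Aa; apply: exists_Max => //; last exact: subset_closure.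
apply: (subclosed_compact _ cY); first exact: closed_closure.
by apply: subset_trans (closureS AY) _; exact: compact_closed.
Qed.

Lemma exists_Min_closure S Y A a : hausdorff_space Z -> compact Y ->
  pointed_closed_convex_cone S -> A `<=` Y -> A a ->
  exists2 z, Min S (closure A) z & S (a - z).
Proof.
move=> hZ cY hS AY Aa.
have [z zA Sz] := exists_Max_closure hZ cY (pcccN hS) AY Aa.
by exists z; [rewrite -Max_Min|rewrite -opprB].
Qed.

(** As [S + int S] lies in [int S], the set [w - int S] is contained in [z - int S]. *)
Lemma Minw_below S A z w : pointed_closed_convex_cone S ->
  Minw S A z -> A w -> S (z - w) -> Minw S A w.
Proof.
move=> hS [Az z0] Aw Szw; split=> //; rewrite -subset0 => v [Av /subS1P iv].
rewrite -z0; split=> //; apply/subS1P.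
rewrite -(subrK w z) -addrA; exact: interior_pcccD.
Qed.

End ConeOrder.

(** * Isolating a generator of positive weight in a convex hull *)

Lemma convex_hull_weight {R : realType} {E : lmodType R} (X A : set E) (y : E) :
  @convex_set R E X -> A `<=` X -> convex_hull A y ->
  exists x x' (t : R), [/\ A x, X x', 0 < t <= 1 & y = t *: x + (1 - t) *: x'].
Proof.
move=> cX AX.
(* The set [C] contains [A] and is shown to be convex, so it contains the hull by minimality. *)
pose C := [set y | exists x x' (t : R),
  [/\ A x, X x', 0 < t <= 1 & y = t *: x + (1 - t) *: x']].
have AC x : A x -> C x.
  move=> Ax; exists x, x, 1; rewrite ltr01 lexx subrr scale0r scale1r addr0.
  by split=> //; exact: AX.
suff: convex_hull A `<=` C by apply.
apply: smallest_sub => //; move/convex_setP: cX => cX.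
apply/convex_setP => _ b l l0 l1 [x [x' [t [Ax Xx' /andP[t0 t1] ->]]]] Cb.
have Xb : X b.
  move: Cb => [z [z' [s [Az Xz' /andP[s0 s1] ->]]]].
  by apply: cX => //; [exact: ltW|exact: AX].
move: l0; rewrite le_eqVlt => /predU1P[<-|l0].
  by rewrite scale0r add0r subr0 scale1r.
have lt1 : l * t <= 1 by rewrite mulr_ile1// ltW.
have lt0 : 0 < l * t by rewrite mulr_gt0.
have lltl : l * t <= l by rewrite ler_piMr// ltW.
(* The generator [x] receives weight [l * t]. If this is 1, nothing remains to renormalise, and the
   point is [x] itself. *)
move: (lt1); rewrite le_eqVlt => /predU1P[lt1E|lt1'].
  have lE : l = 1 by apply/eqP; rewrite eq_le l1/= -lt1E.
  have tE : t = 1 by rewrite -lt1E lE mul1r.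
  by rewrite lE tE subrr !scale0r !scale1r !addr0; exact: AC.
have d0 : 0 < 1 - l * t by rewrite subr_gt0.
(* The remaining weights [l * (1 - t)] of [x'] and [1 - l] of [b] are divided by their sum
   [1 - l * t]. *)
exists x, ((l * (1 - t) / (1 - l * t)) *: x' +
  (1 - l * (1 - t) / (1 - l * t)) *: b), (l * t); split=> //.
- apply: cX => //.
    apply: divr_ge0; last exact: ltW.
    by apply: mulr_ge0; [exact: ltW|rewrite subr_ge0].
  by rewrite ler_pdivrMr// mul1r mulrBr mulr1 lerD2r.
- by rewrite lt0.
- rewrite !scalerDr !scalerA -addrA; congr (_ + (_ *: _ + _ *: _)).
    by rewrite mulrCA mulfV ?mulr1// gt_eqF.
  rewrite mulrBr mulr1 mulrCA mulfV ?gt_eqF//.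
  by rewrite !mulr1 mulrBr mulr1 opprB addrA subrK.
Qed.

(** * Comparing diagonal values with weakly minimal values *)

Lemma diagonal_below_Minw {R : realType} {E Z : topologicalLmodType R}
    (X : set E) (S : set Z) (G : E -> E -> set Z) (A : set E) (y : E) :
  @convex_set R E X -> pointed_closed_convex_cone S -> A `<=` X ->
  convex_hull A y ->
  type_iii_properly_quasiconvex1 S X G ->
  (forall x, A x -> G x y `&` Minw S (\bigcup_(z in X) G x z) !=set0) ->
  exists u v, [/\ (\bigcup_(x in X) G x x) u,
    (\bigcup_(x in X) Minw S (\bigcup_(z in X) G x z)) v & S (v - u)].
Proof.
move=> cX hS AX Ay qG hitA; have [x [x' [t [Ax Xx' /andP[t0 t1] yE]]]] :=
  convex_hull_weight cX AX Ay.
have Xx : X x by exact: AX.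
have Xy : X y.
  by rewrite yE; move/convex_setP: cX; apply => //; exact: ltW.
have [v [Gv Mv]] := hitA x Ax.
have Mx w : Minw S (\bigcup_(z in X) G x z) w ->
  (\bigcup_(x in X) Minw S (\bigcup_(z in X) G x z)) w by exists x.
have [nohit|/set0P[u [Gu Mu]]] :=
  eqVneq (G y y `&` Minw S (\bigcup_(z in X) G x z)) set0; last first.
  exists u, u; rewrite subrr; split; [by exists y|exact: Mx|exact: pccc0].
(* Quasi-convexity concerns weights in the open interval only; for [t = 1] the point [y] is [x], and
   [v] is already a diagonal value. *)
have [tE|tn1] := eqVneq t 1.
  have yx : y = x by rewrite yE tE subrr scale0r scale1r addr0.
  exists v, v; rewrite subrr; split; last exact: pccc0; last exact: Mx.
  by exists y => //; rewrite {1}yx.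
have tlt : 0 < t < 1 by rewrite t0 lt_neqAle tn1.
have := qG x x' y t Xx Xx' Xy tlt x (or_introl erefl).
rewrite -yE => /(_ nohit v Gv) [u Gu [s Ss vE]].
exists u, v; split; [by exists y|exact: Mx|by rewrite -vE addrC addKr].
Qed.

Lemma bigcup_oppF {R : realType} {E Z : topologicalLmodType R} (X : set E)
    (F : E -> E -> set Z) (x : E) :
  \bigcup_(y in X) oppF F x y = [set - z | z in \bigcup_(y in X) F x y].
Proof. by rewrite image_bigcup. Qed.

Theorem theorem4p3 (R : realType) (E Z : topologicalLmodType R)
  (hE : hausdorff_space E) (hZ : hausdorff_space Z)
  (X : set E) (hX : @convex_set R E X)
  (Y : set Z) (hY : compact Y)
  (S : set Z) (hS : pointed_closed_convex_cone S) (hintS : interior S !=set0)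
  (F : E -> E -> set Z)
  (hFY : forall x y, X x -> X y -> F x y `<=` Y)
  (hF0 : forall x y, X x -> X y -> F x y !=set0) :
  ((forall x, X x -> compact (\bigcup_(y in X) F x y)) ->
   weakly_type_v_mu_convex1 S X F ->
   type_iii_properly_quasiconcave1 S X F ->
   condition_gamma S X F ->
   exists z1 z2 : Z,
     [/\ Max S (closure (\bigcup_(x in X) F x x)) z1,
         Min S (closure (\bigcup_(x in X) Maxw S (\bigcup_(y in X) F x y))) z2
       & addS [set z2] S z1])
  /\
  ((forall y, X y -> compact (\bigcup_(x in X) F x y)) ->
   weakly_type_v_mu_concave2 S X F ->
   type_iii_properly_quasiconvex2 S X F ->
   condition_gamma' S X F ->
   exists z1 z2 : Z,
     [/\ Min S (closure (\bigcup_(x in X) F x x)) z1,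
         Max S (closure (\bigcup_(y in X) Minw S (\bigcup_(x in X) F x y))) z2
       & subS [set z2] S z1]).
Proof.
split=> [_ _ qF [m [x [y [ys [_ Xxy cys hF]]]]]|_ _ qF [m [x [y [xs [_ Xxy cxs hF]]]]]].
- have xX : range x `<=` X by move=> _ [i _ <-]; case: (Xxy i).
  have Xys : X ys by move: cys; apply: smallest_sub.
  have [|u [v [[a Xa [u' Fu <-{u}]] [b Xb]]]] :=
    diagonal_below_Minw hX hS xX cys qF.
    (* Condition $(\gamma)$ places some [w'] of [F (x i) ys] above a weakly maximal [w]; for $-F$
       this puts [- w'] below the weakly minimal [- w]. *)
    move=> _ [i _ <-]; have [Fs [w [Fw Mw]]] := hF i.
    have [w' Fw' [s Ss wE]] := Fs w Fw.
    exists (- w'); split; first by exists w'.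
    rewrite bigcup_oppF.
    apply: (@Minw_below _ _ _ _ (- w)) => //.
    + by rewrite -Maxw_oppE; exists w.
    + by exists w' => //; exists ys.
    + by rewrite opprK -wE opprB subrK.
  rewrite bigcup_oppF -Maxw_oppE => -[v' Mv <-{v}] Suv.
  have [||z1 Mz1 Sz1] := @exists_Max_closure _ _ S Y (\bigcup_(x in X) F x x) u' hZ hY hS.
  + by move=> z [c Xc]; exact: hFY.
  + by exists a.
  have [||z2 Mz2 Sz2] := @exists_Min_closure _ _ S Y
    (\bigcup_(x in X) Maxw S (\bigcup_(y in X) F x y)) v' hZ hY hS.
  + by move=> z [c Xc [[d Xd Fz] _]]; exact: hFY Fz.
  + by exists b.
  exists z1, z2; split=> //; apply/addS1P.
  (* The chain is [z2] <= [v'] <= [u'] <= [z1]; negation has reversed the comparison of [u] with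
     [v]. *)
  apply: (pccc_trans hS _ Sz1); apply: (pccc_trans hS Sz2).
  by rewrite addrC -(opprK u').
- have yX : range y `<=` X by move=> _ [i _ <-]; case: (Xxy i).
  have Xxs : X xs by move: cxs; apply: smallest_sub.
  have [|u [v [[a Xa Fu] [b Xb Mv] Suv]]] :=
    diagonal_below_Minw hX hS yX cxs qF.
    move=> _ [i _ <-]; have [Fs [w [Fw Mw]]] := hF i.
    have [w' Fw' [s Ss wE]] := Fs w Fw.
    exists w'; split=> //; apply: (Minw_below hS Mw); first by exists xs.
    by rewrite -wE addrC addKr.
  have [||z1 Mz1 Sz1] := @exists_Min_closure _ _ S Y (\bigcup_(x in X) F x x) u hZ hY hS.
  + by move=> z [c Xc]; exact: hFY.
  + by exists a.
  have [||z2 Mz2 Sz2] := @exists_Max_closure _ _ S Y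
    (\bigcup_(y in X) Minw S (\bigcup_(x in X) F x y)) v hZ hY hS.
  + by move=> z [c Xc [[d Xd Fz] _]]; exact: hFY Fz.
  + by exists b.
  exists z1, z2; split=> //; apply/subS1P.
  (* Here the chain is [z1] <= [u] <= [v] <= [z2]. *)
  by apply: (pccc_trans hS _ Sz2); exact: pccc_trans hS Sz1 Suv.
Qed.
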